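(* Let $X=\{0,1\}^{\mathbb N}$ with its Borel $\sigma$-algebra, let $\mu$ be the symmetric Bernoulli measure on $X$ (the product of the uniform probability measures on $\{0,1\}$), and let $T:X\to X$ be the left shift $T((x_i)_{i\ge1})=(x_{i+1})_{i\ge1}$. Let $(\lambda_n)_{n\ge1}$ be a non-decreasing sequence of positive integers such that $$\sum_{n}\frac{1}{2^{\lambda_n}}=\infty,\qquad \frac{n}{2^{\lambda_n}}\to 0 .$$ Let $E_n=\{x\in X: x_1=\cdots=x_{\lambda_n}=0\}$ and define $f_n=n\,\mathbf 1_{E_n}$ for $n\ge 1$, and $f_0=0$. Then $f_n\to0$ $\mu$-a.e. and $\|f_n\|_{L^1(\mu)}\to0$, but for $\mu$-almost every $x$ $$\limsup_{N\to\infty}\frac{1}{2N}\sum_{n=0}^{2N-1}f_n(T^{2N-n}x)\ \ge\ \frac12 .$$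
   Context: $\mathbb N=\{1,2,\ldots\}$. $\mathbf 1_E$ denotes the indicator function of $E$. *)

(* Defs.v *)
From HB Require Import structures.
From mathcomp Require Import all_boot all_order all_algebra.
From mathcomp Require Import all_classical all_reals all_analysis.
From mathcomp Require Import measurable_realfun zify ring lra.

Set Implicit Arguments.
Unset Strict Implicit.
Unset Printing Implicit Defensive.

Import Order.TTheory GRing.Theory Num.Theory.
Import numFieldNormedType.Exports.

Local Open Scope classical_set_scope.
Local Open Scope ring_scope.

(* The Cantor space {0,1}^N with its Borel sigma-algebra. Coordinates are
   numbered from 0, so that [x i] is the coordinate x_{i+1}; the digit 0 is
   [false] and the digit 1 is [true]. *)
Definition X : Type := g_sigma_algebraType (@open cantor_space).

HB.instance Definition _ := Measurable.on X.

Definition left_shift (x : X) : X := fun i => x i.+1.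

(* [mu] is the product of countably many copies of [p]: it has the product
   value on every finite-dimensional rectangle. *)
Definition is_product_measure (R : realType) (p : set bool -> \bar R)
    (mu : set X -> \bar R) :=
  forall (n : nat) (A : nat -> set bool),
    mu [set x : X | forall i, (i < n)%N -> A i (x i)] =
    (\prod_(i < n) p (A i))%E.

Definition symmetric_bernoulli (R : realType) (mu : set X -> \bar R) :=
  is_product_measure (bernoulli_prob (2^-1 : R)) mu.

Definition E_ (lambda : nat -> nat) (n : nat) : set X :=
  [set x : X | forall i, (i < lambda n)%N -> x i = false].

(* For n = 0 this is the zero function, whatever [lambda 0] is. *)
Definition f_ (R : realType) (lambda : nat -> nat) (n : nat) (x : X) : R :=
  n%:R * \1_(E_ lambda n) x.

Lemma measurable_coord (i : nat) (A : set bool) :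
  measurable [set x : X | A (x i)].
Proof.
apply: sub_sigma_algebra.
rewrite -[X in open X]/((@proj nat (fun=> bool) i) @^-1` A).
by apply: open_comp; [move=> x _; exact: proj_continuous | exact: discrete_open].
Qed.

Lemma measurable_rectangle (n : nat) (A : nat -> set bool) :
  measurable [set x : X | forall i, (i < n)%N -> A i (x i)].
Proof.
rewrite (_ : mkset _ = \bigcap_(i in `I_n) [set x : X | A i (x i)]) //.
by apply: bigcap_measurableType => i _; exact: measurable_coord.
Qed.

Definition cyl (s : seq bool) : set X :=
  [set x | forall i, (i < size s)%N -> x i = nth false s i].

Lemma open_cylinders (U : set cantor_space) : open U ->
  U = \bigcup_(s in [set s | cyl s `<=` U]) cyl s.
Proof.
move=> oU; apply/seteqP; split => [x Ux|x [s /= sU xs]]; last exact: sU.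
apply: contrapT => nx.
have /choice[y yP] n : exists y : cantor_space,
    (forall i, (i < n)%N -> y i = x i) /\ ~ U y.
  apply: contrapT => ny; apply: nx; exists (mkseq x n) => /=.
    move=> y yx; apply: contrapT => nUy; apply: ny; exists y; split => // i ni.
    by rewrite yx ?size_mkseq// nth_mkseq.
  by move=> i; rewrite size_mkseq => ni; rewrite nth_mkseq.
have yx : y @ \oo --> x.
  apply/pointwise_cvgP => i; apply: cvg_near_cst.
  exists i.+1 => // n /= ni; exact: (yP n).1.
have [N _ NU] := yx U (open_nbhs_nbhs (conj oU Ux)).
exact: (yP N).2 (NU N (leqnn N)).
Qed.

Lemma measurable_to_X d (T : measurableType d) (g : T -> X) :
  (forall i, measurable [set t | g t i]) -> measurable_fun setT g.
Proof.
move=> mg; apply: (@measurability _ _ T X setT g (@open cantor_space)) => // _ [U oU <-].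
rewrite setTI (open_cylinders oU) bigcup_mkcond preimage_bigcup.
apply: countable_bigcupT_measurable => // s; case: ifPn => _; last by rewrite preimage_set0.
rewrite (_ : _ @^-1` _ = \bigcap_(i in `I_(size s)) [set t | g t i = nth false s i]) //.
apply: bigcap_measurableType => i _.
case: (nth false s i); first exact: mg.
rewrite (_ : mkset _ = ~` [set t | g t i]); first exact: measurableC.
by apply/seteqP; split => t /=; [move=> -> | move/negP/negbTE].
Qed.

Lemma product_measure_of_points (R : realType) (p : probability bool R)
    (mu : probability X R) :
  (forall n (a : nat -> bool),
     mu [set x : X | forall i, (i < n)%N -> x i = a i] =
     (\prod_(i < n) p [set a i])%E) -> is_product_measure p mu.
Proof.
move=> H n.
suff P m : (m <= n)%N -> forall A : nat -> set bool,
    (forall i, (m <= i < n)%N -> exists b, A i = [set b]) ->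
    mu [set x : X | forall i, (i < n)%N -> A i (x i)] = (\prod_(i < n) p (A i))%E.
  by move=> A; apply: (P n) => // i; case: ltngtP.
elim: m => [_ A hA|m IH mn A hA].
  have /choice[a aP] i : exists b, (i < n)%N -> A i = [set b].
    by have [/(hA i)[b ->]|] := ltnP i n; [exists b|exists true].
  rewrite (_ : mkset _ = [set x : X | forall i, (i < n)%N -> x i = a i]).
    by rewrite H; apply: eq_bigr => i _; rewrite aP.
  by apply/seteqP; split => x /= xA i ni; move: (xA i ni); rewrite aP.
pose A' b i := if i == m then A m `&` [set b] else A i.
have A'E b : mu [set x : X | forall i, (i < n)%N -> A' b i (x i)] =
    (\prod_(i < n) p (A' b i))%E.
  have [Ab|nAb] := pselect (A m b).
    apply: IH => [|i /andP[mi ni]]; first exact: ltnW.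
    rewrite /A'; case: eqP => [_|/eqP im]; last by apply: hA; lia.
    by exists b; apply/seteqP; split => c /= => [[]|->].
  have A0 : A m `&` [set b] = set0.
    by apply/seteqP; split => // c [/= Ac cb]; apply: nAb; rewrite -cb.
  rewrite (_ : mkset _ = set0); last first.
    apply/seteqP; split => // x /= /(_ _ mn).
    by rewrite /A' eqxx A0.
  by rewrite measure0 (bigD1 (Ordinal mn))//= /A' eqxx A0 measure0 mul0e.
rewrite (_ : mkset _ = [set x : X | forall i, (i < n)%N -> A' true i (x i)] `|`
  [set x : X | forall i, (i < n)%N -> A' false i (x i)]); last first.
  apply/seteqP; split => x /=.
    move=> xA; case xm: (x m); [left|right] => i ni; rewrite /A';
    by case: eqP => [im|_]; [subst i; split => //; exact: xA|exact: xA].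
  by move=> [] xA i /xA; rewrite /A'; case: eqP => [im|] // [+ _]; subst i.
rewrite measureU; [|exact: measurable_rectangle|exact: measurable_rectangle|]; last first.
  apply/seteqP; split => // x /= [] /(_ _ mn) + /(_ _ mn).
  by rewrite /A' eqxx => -[_ /= ->] [].
transitivity (\prod_(i < n) p (A' true i) + \prod_(i < n) p (A' false i))%E.
  by rewrite -2!A'E.
rewrite (bigD1 (Ordinal mn))//= [X in (_ + X)%E](bigD1 (Ordinal mn))//=.
rewrite [RHS](bigD1 (Ordinal mn))//=.
have E b : (\prod_(i < n | i != Ordinal mn) p (A' b i) =
   \prod_(i < n | i != Ordinal mn) p (A i))%E.
  apply: eq_bigr => i im; rewrite /A'; case: eqP => // im'.
  by move: im; rewrite -val_eqE /= im' eqxx.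
rewrite !E /A' !eqxx -ge0_muleDl//.
congr (_ * _)%E.
rewrite -measureU//; first by rewrite -setIUr -setT_bool setIT.
by apply/seteqP; split => // c [] [_ /= ->] [].
Qed.

(* The map r |-> binary digits of r; it pushes the Lebesgue measure on [0, 1[
   forward to the symmetric Bernoulli measure. *)
Definition digits (R : realType) (r : R) : X := fun i => odd (Num.truncn (2 ^+ i.+1 * r)).

Lemma truncn_half (R : realType) (r : R) : 0 <= r ->
  Num.truncn r = (Num.truncn (2 * r))./2.
Proof.
move=> r0; apply: truncn_def.
have /andP[] := truncn_itv (mulr_ge0 (ler0n R 2) r0).
set k := Num.truncn _ => k1 k2.
have kE := odd_double_half k.
have : (k%:R : R) = (odd k)%:R + 2 * (k./2)%:R.
  by rewrite -{1}kE natrD -muln2 natrM mulrC.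
rewrite -!natr1 in k2 *; case: (odd k) => /= e; lra.
Qed.

Fixpoint dyadic_num (a : nat -> bool) n :=
  if n is m.+1 then (a m + (dyadic_num a m).*2)%N else 0%N.

Lemma digitsE (R : realType) (r : R) (a : nat -> bool) n : 0 <= r ->
  (r < 1 /\ forall i, (i < n)%N -> digits r i = a i) <->
  Num.truncn (2 ^+ n * r) = dyadic_num a n.
Proof.
move=> r0; elim: n => [|n IH].
  rewrite expr0 mul1r /=; split => [[r1 _]|]; last first.
    by move=> /eqP; rewrite truncn_eq// => /andP[_ r1]; split.
  by apply/eqP; rewrite truncn_eq// r0.
have h : Num.truncn (2 ^+ n * r) = (Num.truncn (2 ^+ n.+1 * r))./2.
  by rewrite truncn_half ?mulr_ge0 ?exprn_ge0// mulrA -exprS.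
split => [[r1 ra]|rn].
  have /IH hn : r < 1 /\ forall i, (i < n)%N -> digits r i = a i.
    by split => // i ni; apply: ra; exact: ltnW.
  by rewrite /= -hn h -(ra n (leqnn _)) /digits odd_double_half.
have [r1 ra] : r < 1 /\ forall i, (i < n)%N -> digits r i = a i.
  by apply/IH; rewrite h rn /= half_bit_double.
split => // i; rewrite ltnS leq_eqVlt => /predU1P[->|]; last exact: ra.
by rewrite /digits rn /= oddD odd_double addbF oddb.
Qed.

Lemma digits_itv (R : realType) (a : nat -> bool) n :
  [set r : R | forall i, (i < n)%N -> digits r i = a i] `&` `[0, 1[ =
  `[(dyadic_num a n)%:R / 2 ^+ n, (dyadic_num a n).+1%:R / 2 ^+ n[%classic.
Proof.
apply/seteqP; split => r /=; rewrite !in_itv/=.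
  move=> [ra /andP[r0 r1]].
  have /eqP := (digitsE a n r0).1 (conj r1 ra).
  rewrite truncn_eq ?mulr_ge0 ?exprn_ge0//.
  by rewrite ler_pdivrMr ?exprn_gt0// ltr_pdivlMr ?exprn_gt0// mulrC.
move=> rI.
have r0 : 0 <= r.
  by move: rI => /andP[+ _]; apply: le_trans; rewrite divr_ge0 ?exprn_ge0.
have [|r1 ra] := (digitsE a n r0).2; last by rewrite r0 r1.
apply/eqP; rewrite truncn_eq ?mulr_ge0 ?exprn_ge0//.
by move: rI; rewrite ler_pdivrMr ?exprn_gt0// ltr_pdivlMr ?exprn_gt0// mulrC.
Qed.

Lemma measurable_digits (R : realType) : measurable_fun [set: measurableTypeR R] (@digits R).
Proof.
apply: measurable_to_X => i.
rewrite (_ : mkset _ = \bigcup_(k in [set k | odd k])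
   ((fun r : R => 2 ^+ i.+1 * r) @^-1` [set y | Num.truncn y = k])); last first.
  apply/seteqP; split => r /=; first by exists (Num.truncn (2 ^+ i.+1 * r)).
  by move=> [k /= ok rk]; rewrite /digits rk.
apply: bigcup_measurable => k _; rewrite -[X in measurable X]setTI.
have mm : measurable_fun [set: measurableTypeR R] (fun r : R => 2 ^+ i.+1 * r).
  exact: mulrl_measurable.
apply: mm => //.
have -> : [set y : R | Num.truncn y = k] =
    if k is 0%N then `]-oo, 1[%classic else `[k%:R, k.+1%:R[%classic.
  apply/seteqP; split => y /=.
    move=> <-; case E : (Num.truncn y) => [|m] /=; rewrite in_itv/=.
      by have := truncnS_gt y; rewrite E.
    rewrite -E truncnS_gt andbT truncn_le.
    have : (0 < Num.truncn y)%N by rewrite E.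
    by rewrite truncn_gt0; apply: le_trans.
  case: k => [|k] /=; rewrite in_itv/=; first by rewrite ltNge => /truncn0Pn.
  exact: truncn_def.
by case: k.
Qed.

Lemma exists_symmetric_bernoulli (R : realType) :
  exists mu : probability X R, symmetric_bernoulli mu.
Proof.
pose m0 := mrestr (@lebesgue_measure R)
  (measurable_itv `[0, 1[ : measurable (_ : set (measurableTypeR R))).
pose m := pushforward m0 (@digits R : measurableTypeR R -> X).
have mE n (a : nat -> bool) :
    m [set x : X | forall i, (i < n)%N -> x i = a i] = ((2^-1 : R) ^+ n)%:E.
  rewrite /m /m0 /pushforward /mrestr /= digits_itv lebesgue_measure_itv /=.
  rewrite lte_fin ltr_pM2r ?invr_gt0 ?exprn_gt0// ltr_nat leqnn.
  by rewrite -EFinD -mulrBl -natrB// subSnn mul1r exprVn.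
have m1 : m setT = 1%E.
  by rewrite -(mE 0%N xpred0); congr (m _); apply/seteqP; split.
pose mm := measure_function_pushforward__canonical__measure_function_Measure
  (measure_function_mrestr__canonical__measure_function_Measure lebesgue_measure
     (measurable_itv `[0, 1[ : measurable (_ : set (measurableTypeR R))))
  (@measurable_digits R).

pose M : {measure set X -> \bar R} := mm.
pose P : probability X R := HB.pack (M : set X -> \bar R) M
  (@Measure_isProbability.Build _ _ R M m1).
exists P.

have p01 : 0 <= (2^-1 : R) <= 1 by lra.
apply: product_measure_of_points => n a.
transitivity (m [set x : X | forall i, (i < n)%N -> x i = a i]) => //.
rewrite mE.
rewrite (eq_bigr (fun=> (2^-1 : R)%:E)) => [|i _].
  by elim: n => [|n IH]; rewrite ?big_ord0// big_ord_recr/= -IH exprSr EFinM.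
transitivity (bernoulli_prob (2^-1 : R) [set a i]) => //.
rewrite bernoulli_probE// !diracE.
have e : unstable.onem (2^-1 : R) = 2^-1 by rewrite /unstable.onem; lra.
rewrite e; case: (a i).
  by rewrite mem_set// memNset//= mule0 mule1 adde0.
by rewrite memNset// mem_set//= mule0 mule1 add0e.
Qed.

(* Main.v *)
(** A non-summable sequence of events, pairwise independent or negatively
    correlated, happens infinitely often almost surely: Chebyshev's inequality
    bounds the probability that none of finitely many of them happens by the
    inverse of the sum of their probabilities. Apply this to the events
    [x_N = 1, x_(N+1) = ... = x_(N+lambda_N) = 0]: two of them have disjoint
    windows, hence are independent, or overlap, and then they are disjoint.
    When the [N]-th event happens, [T^N x] belongs to [E_N], so the single term
    [n = N] already makes the average over [2N] terms at least [N / 2N]. *)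
Require Import Defs.
From mathcomp Require Import all_boot all_order all_algebra.
From mathcomp Require Import all_classical all_reals all_analysis.
From mathcomp Require Import measurable_realfun zify ring lra.
Import Order.TTheory GRing.Theory Num.Theory.
Import numFieldNormedType.Exports.
Local Open Scope classical_set_scope.
Local Open Scope ring_scope.

(** * Second moments and a Borel-Cantelli lemma *)

Lemma integral_sum_indic d (T : measurableType d) (R : realType)
    (mu : {measure set T -> \bar R}) (I : Type) (s : seq I) (A : I -> set T)
    (c : R) : 0 <= c -> (forall i, measurable (A i)) ->
  (\int[mu]_x (\sum_(i <- s) c * \1_(A i) x)%:E = \sum_(i <- s) c%:E * mu (A i))%E.
Proof.
move=> c0 mA; under eq_integral do rewrite -sumEFin.
rewrite ge0_integral_sum//.
- apply: eq_bigr => i _; under eq_integral do rewrite EFinM.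
  by rewrite ge0_integralZl_EFin// ?integral_indic ?setIT//; exact/measurable_EFinP.
- by move=> i; apply/measurable_EFinP; exact: measurable_funM.
- by move=> i x _; rewrite lee_fin mulr_ge0 ?sqr_ge0.
Qed.

(* Expand [0 <= (S - e)^2] with [S] the sum of the indicators and [e] its mean:
   [(S - e)^2] is [e^2] where [S] vanishes. *)
Lemma second_moment_avoidance d (T : measurableType d) (R : realType)
    (mu : probability T R) (B : nat -> set T) (p : nat -> R) (s : seq nat) :
  (forall i, measurable (B i)) -> (forall i, mu (B i) = (p i)%:E) ->
  (forall i j, i != j -> (mu (B i `&` B j) <= (p i * p j)%:E)%E) -> uniq s ->
  (((\sum_(i <- s) p i) ^+ 2)%:E * mu (~` \bigcup_(i in [set` s]) B i) <=
    (\sum_(i <- s) p i)%:E)%E.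
Proof.
move=> mB muB BB us; set e := \sum_(i <- s) p i; set Z := ~` _.
have p0 i : 0 <= p i by rewrite -lee_fin -muB.
have e0 : 0 <= e by exact: sumr_ge0.
have mZ : measurable Z by apply: measurableC; exact: bigcup_measurable.
pose q (ij : nat * nat) := B ij.1 `&` B ij.2.
have mq ij : measurable (q ij) by exact: measurableI.
pose ss := [seq (i, j) | i <- s, j <- s].
(* The cross term [2 e S] is moved to the left, so that both sides are nonnegative and can be
   integrated termwise in the extended reals. *)
have key x : e ^+ 2 * \1_Z x + \sum_(i <- s) (2 * e) * \1_(B i) x <=
    e ^+ 2 * \1_setT x + \sum_(ij <- ss) 1 * \1_(q ij) x :> R.
  pose S : R := \sum_(i <- s) \1_(B i) x.
  have -> : \sum_(ij <- ss) 1 * \1_(q ij) x = S * S.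
    rewrite big_allpairs /S big_distrl; apply: eq_bigr => i _ /=.
    rewrite big_distrr; apply: eq_bigr => j _ /=.
    by rewrite mul1r /q /= indicI.
  rewrite -big_distrr /= -/S indicT /= mulr1.
  rewrite indicE; case: (boolP (x \in Z)) => [|_]; last first.
    by rewrite mulr0 add0r; have := sqr_ge0 (S - e); nra.
  rewrite inE => Zx; suff -> : S = 0 by rewrite mulr1 !mulr0.
  rewrite /S big_seq big1// => i si; rewrite indicE memNset// => Bix.
  by apply: Zx; exists i.
have mf (I : Type) (r : seq I) (A : I -> set T) (c : R) : (forall i, measurable (A i)) ->
    measurable_fun setT (EFin \o fun x => \sum_(i <- r) c * \1_(A i) x).
  move=> mA; apply/measurable_EFinP; apply: measurable_sum => i.
  exact: measurable_funM.
have mf1 (A : set T) : measurable A -> measurable_fun setT (EFin \o fun x => e ^+ 2 * \1_A x).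
  by move=> mA; apply/measurable_EFinP; exact: measurable_funM.
have IE (D : set T) (I : Type) (r : seq I) (A : I -> set T) (c : R) :
    measurable D -> 0 <= c -> (forall i, measurable (A i)) ->
    (\int[mu]_x ((e ^+ 2 * \1_D x)%:E + (\sum_(i <- r) c * \1_(A i) x)%:E) =
     (e ^+ 2)%:E * mu D + \sum_(i <- r) c%:E * mu (A i))%E.
  move=> mD c0 mA; rewrite ge0_integralD//.
  - rewrite integral_sum_indic//; congr (_ + _)%E.
    have := integral_sum_indic _ _ _ mu _ [:: tt] (fun=> D) _ (sqr_ge0 e) (fun=> mD).
    by rewrite big_seq1 => <-; apply: eq_integral => x _; rewrite big_seq1.
  - by move=> x _; rewrite lee_fin mulr_ge0 ?sqr_ge0.
  - exact: mf1.
  - by move=> x _; rewrite lee_fin sumr_ge0// => i _; rewrite mulr_ge0.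
  - exact: mf.
have : (\int[mu]_x ((e ^+ 2 * \1_Z x)%:E + (\sum_(i <- s) (2 * e) * \1_(B i) x)%:E) <=
    \int[mu]_x ((e ^+ 2 * \1_setT x)%:E + (\sum_(ij <- ss) 1 * \1_(q ij) x)%:E))%E.
  apply: ge0_le_integral => //.
  - by move=> x _; rewrite lee_fin addr_ge0 ?mulr_ge0 ?sqr_ge0 ?sumr_ge0// => i _;
    rewrite !mulr_ge0.
  - by apply: emeasurable_funD; [exact: mf1|exact: mf].
  - by apply: emeasurable_funD; [exact: mf1|exact: mf].
  - by move=> x _; rewrite -!EFinD lee_fin key.
rewrite !IE ?mulr_ge0// probability_setT mule1.
have -> : (\sum_(i <- s) (2 * e)%:E * mu (B i) = (2 * e * e)%:E)%E.
  under eq_bigr do rewrite muB -EFinM.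
  by rewrite sumEFin -big_distrr.
(* A diagonal pair contributes [p i], an off-diagonal one at most [p i * p j]. *)
have : (\sum_(ij <- ss) 1%:E * mu (q ij) <= (e * e + e)%:E)%E.
  rewrite big_allpairs /= {1 3}/e big_distrl -big_split /= -sumEFin.
  rewrite big_seq [leRHS]big_seq; apply: lee_sum => i si.
  have -> : e = p i + \sum_(j <- s | j != i) p j by rewrite /e (bigD1_seq i).
  rewrite (bigD1_seq i)//= mul1e /q /= setIid muB.
  have : (\sum_(j <- s | j != i) 1%:E * mu (B i `&` B j) <=
      (p i * \sum_(j <- s | j != i) p j)%:E)%E.
    rewrite big_distrr /= -sumEFin; apply: lee_sum => j ji.
    by rewrite mul1e BB// eq_sym.
  move=> /(leeD2l (p i)%:E) /le_trans; apply.
  by rewrite -EFinD lee_fin; have := p0 i; nra.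
move=> /(leeD2l (e ^+ 2)%:E) h /le_trans /(_ h).
have : mu Z \is a fin_num by exact: fin_num_measure.
by move=> /fineK <-; rewrite -!EFinM -!EFinD !lee_fin; nra.
Qed.

Lemma nneseries_pinfty_unbounded (R : realType) (p : nat -> R) (m : nat) (C : R) :
  (forall i, 0 <= p i) -> (\sum_(m <= i <oo) (p i)%:E = +oo)%E ->
  exists n, C < \sum_(m <= i < n) p i.
Proof.
move=> p0 poo; apply: contrapT => /forallNP h.
suff : (\sum_(m <= i <oo) (p i)%:E <= C%:E)%E by rewrite poo.
apply: lime_le; first by apply: is_cvg_nneseries => i _ _; rewrite lee_fin.
apply: nearW => n; rewrite sumEFin lee_fin leNgt; exact/negP.
Qed.

(** If avoiding every event from [n] on had probability [z > 0], a block of events from [n] on with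
    total probability [e > 1 / z] would contradict the second-moment bound [e ^ 2 * z <= e]. *)
Lemma borel_cantelli_negative_correlation d (T : measurableType d) (R : realType)
    (mu : probability T R) (B : nat -> set T) (p : nat -> R) :
  (forall i, measurable (B i)) -> (forall i, mu (B i) = (p i)%:E) ->
  (forall i j, i != j -> (mu (B i `&` B j) <= (p i * p j)%:E)%E) ->
  (forall C, exists n, C < \sum_(0 <= i < n) p i) ->
  {ae mu, forall x, lim_sup_set B x}.
Proof.
move=> mB muB BB poo.
have p0 i : 0 <= p i by rewrite -lee_fin -muB.
pose Z n := ~` \bigcup_(j in [set j | (n <= j)%N]) B j.
have mZ n : measurable (Z n) by apply: measurableC; exact: bigcup_measurable.
apply: (@negligibleS _ _ _ _ (\bigcup_n Z n)).
  move=> x /= /existsNP[n] /not_implyP[_ nx]; by exists n.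
apply: negligible_bigcup => n; apply/negligibleP => //.
have Zfin : mu (Z n) \is a fin_num by exact: fin_num_measure.
have : 0 <= fine (mu (Z n)) by exact: fine_ge0.
rewrite le_eqVlt => /predU1P[Z0|Z0]; first by apply: etrans (esym (fineK Zfin)) _; rewrite -Z0.
(* Adding the sum below [n] to the threshold forces [K] past [n] and leaves more than the inverse of
   [mu (Z n)] to the block from [n] to [K]. *)
have [K] := poo (\sum_(0 <= i < n) p i + (fine (mu (Z n)))^-1).
have [nK|/ltnW Kn] := leqP n K; last first.
  rewrite (big_cat_nat (leq0n K) Kn)/= -addrA ltNge lerDl addr_ge0 ?sumr_ge0//.
  by rewrite invr_ge0 ltW.
rewrite (big_cat_nat (leq0n n) nK)/= ltrD2l.
have := second_moment_avoidance _ _ _ mu B p (index_iota n K) mB muB BB (iota_uniq _ _).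
set e := \sum_(n <= i < K) p i => he eZ.
have : ((e ^+ 2)%:E * mu (Z n) <= e%:E)%E.
  apply: le_trans he; apply: lee_wpmul2l; first by rewrite lee_fin sqr_ge0.
  apply: le_measure; rewrite ?inE//.
    by apply: measurableC; apply: bigcup_measurable.
  apply: subsetC => x [i /= + Bi]; rewrite mem_index_iota => /andP[ni _].
  by exists i.
rewrite -(fineK Zfin) -EFinM lee_fin.
have e0 : 0 < e by apply: lt_trans eZ; rewrite invr_gt0.
rewrite expr2 -mulrA -[leRHS]mulr1 ler_pM2l// leNgt.
by rewrite -(ltr_pdivrMr _ _ Z0) mul1r eZ.
Qed.

(** * Cylinders and runs under the Bernoulli measure *)

(** Any finite list of coordinates is allowed, not only an initial segment, so that two windows
    combine by concatenation. *)
Definition cylinder (s : seq nat) (a : nat -> bool) : set X :=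
  [set x | forall i, i \in s -> x i = a i].

Lemma cylinder_rectangle (s : seq nat) (a : nat -> bool) (n : nat) :
  (forall i, i \in s -> (i < n)%N) ->
  cylinder s a =
  [set x | forall i, (i < n)%N -> (if i \in s then [set a i] else setT) (x i)].
Proof.
move=> sn; apply/seteqP; split => x /= xs i.
  by move=> _; case: ifPn => // /xs.
by move=> si; have := xs i (sn i si); rewrite si.
Qed.

Lemma seq_nat_bounded (s : seq nat) : exists n, forall i, i \in s -> (i < n)%N.
Proof. by exists (\max_(i <- s) i).+1 => i si; rewrite ltnS; apply: leq_bigmax_seq si _. Qed.

Lemma measurable_cylinder (s : seq nat) (a : nat -> bool) : measurable (cylinder s a).
Proof.
have [n sn] := seq_nat_bounded s.
rewrite (cylinder_rectangle s a n sn).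
exact: (@measurable_rectangle n (fun i => if i \in s then [set a i] else setT)).
Qed.

(** In the enclosing rectangle, coordinates outside [s] have the full factor of mass 1; each of the
    distinct coordinates in [s] contributes one half. *)
Lemma cylinder_measure (R : realType) (mu : probability X R) (s : seq nat)
    (a : nat -> bool) : symmetric_bernoulli mu -> uniq s ->
  mu (cylinder s a) = ((2 ^+ size s)^-1)%:E.
Proof.
move=> bmu us; have [n sn] := seq_nat_bounded s.
rewrite (cylinder_rectangle s a n sn)
  (bmu n (fun i => if i \in s then [set a i] else setT)).
have p01 : 0 <= (2^-1 : R) <= 1 by lra.
have half : unstable.onem (2^-1 : R) = 2^-1 by rewrite /unstable.onem; lra.
have pE (i : nat) : bernoulli_prob (2^-1 : R) (if i \in s then [set a i] else setT) =
    (if i \in s then 2^-1 else 1)%:E.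
  case: ifPn => _; last exact: (@probability_setT _ _ _ (bernoulli_prob (2^-1 : R))).

  rewrite bernoulli_probE// !diracE half.
  by case: (a i); [rewrite mem_set// memNset//= mule0 mule1 adde0|
    rewrite memNset// mem_set//= mule0 mule1 add0e].
under eq_bigr do rewrite pE.
rewrite prodEFin; congr EFin.
rewrite -(big_mkord xpredT (fun i => if i \in s then 2^-1 else 1 : R)) -big_mkcond.
rewrite -big_filter (perm_big s)/=; first by rewrite big_const_seq iter_mulr_1 count_predT exprVn.
apply: uniq_perm => //; first by rewrite filter_uniq ?iota_uniq.
move=> i; rewrite mem_filter mem_index_iota /=.
by case: (boolP (i \in s)) => // /sn ->.
Qed.

(* Coordinates are numbered from 0, so with [l k = lambda k.+1] this is the event
   of index [N = k + 1]. *)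
Definition exact_run (l : nat -> nat) (k : nat) : set X :=
  cylinder (iota k (l k).+1) (fun i => i == k).

Lemma exact_run_measure (R : realType) (mu : probability X R) (l : nat -> nat) (k : nat) :
  symmetric_bernoulli mu -> mu (exact_run l k) = ((2 ^+ (l k).+1)^-1)%:E.
Proof. by move=> bmu; rewrite cylinder_measure ?iota_uniq// size_iota. Qed.

(** For [j < k], if [k] lies in the window of [j], the first run wants a 0 there and the second a 1;
    otherwise the windows are disjoint and the lengths add up. *)
Lemma exact_run_negative_correlation (R : realType) (mu : probability X R)
    (l : nat -> nat) (j k : nat) : symmetric_bernoulli mu -> j != k ->
  (mu (exact_run l j `&` exact_run l k) <=
   ((2 ^+ (l j).+1)^-1 * (2 ^+ (l k).+1)^-1)%:E)%E.
Proof.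
move=> bmu; wlog jk : j k / (j < k)%N => [h|].
  rewrite neq_ltn => /orP[jk|kj].
    by apply: h; rewrite ?neq_ltn ?jk.
  by rewrite setIC mulrC; apply: h; rewrite ?neq_ltn ?kj.
move=> _; have [kj|jlk] := leqP k (j + l j).
  rewrite (_ : _ `&` _ = set0) ?measure0 ?lee_fin//.
  apply/seteqP; split => // x [] /(_ k) + /(_ k).
  rewrite !mem_iota => -> ; last by lia.
  by rewrite eqxx gtn_eqF// => /(_ _)/negP; case; lia.
pose s := iota j (l j).+1 ++ iota k (l k).+1.
(* This pattern restricts to each run's own pattern, since neither window contains the start of the
   other. *)
apply: (@le_trans _ _ (mu (cylinder s (fun i => (i == j) || (i == k))))).
  apply: le_measure; rewrite ?inE; [|exact: measurable_cylinder|].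
    by apply: measurableI; exact: measurable_cylinder.
  move=> x [/= xj xk] i; rewrite mem_cat => /orP[] si.
    rewrite xj//; move: si; rewrite mem_iota => si.
    by rewrite (_ : (i == k) = false) ?orbF//; lia.
  rewrite xk//; move: si; rewrite mem_iota => si.
  by rewrite (_ : (i == j) = false)//; lia.
rewrite cylinder_measure//.
  by rewrite size_cat !size_iota exprD invfM.
rewrite cat_uniq; apply/and3P; split; rewrite ?iota_uniq//; apply/hasPn => i.
by rewrite !mem_iota; lia.
Qed.

(** * The sets [E_] and the functions [f_] *)

Lemma iter_left_shift (m : nat) (x : X) (i : nat) : iter m left_shift x i = x (m + i)%N.
Proof. by elim: m i => //= m IH i; rewrite /left_shift IH addnS. Qed.

Lemma EE_cylinder (lambda : nat -> nat) (n : nat) :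
  E_ lambda n = cylinder (iota 0 (lambda n)) xpred0.
Proof. by apply/seteqP; split => x /= xE i; have := xE i; rewrite mem_iota. Qed.

Lemma measurable_E (lambda : nat -> nat) (n : nat) : measurable (E_ lambda n).
Proof. by rewrite EE_cylinder; exact: measurable_cylinder. Qed.

Lemma E_measure (R : realType) (mu : probability X R) (lambda : nat -> nat) (n : nat) :
  symmetric_bernoulli mu -> mu (E_ lambda n) = ((2 ^+ lambda n)^-1)%:E.
Proof. by move=> bmu; rewrite EE_cylinder cylinder_measure ?iota_uniq// size_iota. Qed.

Lemma f_ge0 (R : realType) (lambda : nat -> nat) (n : nat) (x : X) :
  0 <= f_ R lambda n x.
Proof. by rewrite /f_ mulr_ge0. Qed.

Lemma Lnorm1_f (R : realType) (mu : probability X R) (lambda : nat -> nat) (n : nat) :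
  symmetric_bernoulli mu ->
  ('N[mu]_1 [EFin \o f_ R lambda n])%E = (n%:R / 2 ^+ lambda n)%:E.
Proof.
move=> bmu; rewrite Lnorm1.
under eq_integral do rewrite /= ger0_norm ?f_ge0// /f_ EFinM.
rewrite ge0_integralZl_EFin//; last first.
  by apply/measurable_EFinP; apply: measurable_indic; exact: measurable_E.
rewrite integral_indic//; last exact: measurable_E.
by rewrite setIT EFinM; congr (_ * _)%E; exact: E_measure.
Qed.

(** Once the ratio is below 1, [n < 2 ^ lambda n]; taking [n >= 2 ^ i] then gives [i < lambda n]. *)
Lemma lambda_unbounded (R : realType) (lambda : nat -> nat) (i : nat) :
  (n%:R / 2 ^+ lambda n : R) @[n --> \oo] --> (0 : R) ->
  \forall n \near \oo, (i < lambda n)%N.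
Proof.
move=> /cvgr_lt /(_ 1 ltr01) small; near=> n.
have : n%:R / 2 ^+ lambda n < 1 :> R by near: n.
rewrite ltr_pdivrMr ?exprn_gt0// mul1r -natrX ltr_nat => nl.
rewrite -(@ltn_exp2l 2)//; apply: leq_ltn_trans nl.
by near: n; exact: nbhs_infty_ge.
Unshelve. all: by end_near. Qed.

(** A single digit 1 at [i] keeps [x] out of [E_ lambda n] as soon as [lambda n > i], so the
    sequence is eventually zero. *)
Lemma f_cvg0 (R : realType) (lambda : nat -> nat) (x : X) (i : nat) :
  (n%:R / 2 ^+ lambda n : R) @[n --> \oo] --> (0 : R) -> x i ->
  f_ R lambda n x @[n --> \oo] --> (0 : R).
Proof.
move=> ratio xi; apply: cvg_near_cst.
have := @lambda_unbounded R lambda i ratio; apply: filterS => n il.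
rewrite /f_ indicE memNset ?mulr0// => /(_ i il).
by rewrite xi.
Qed.

Lemma exact_run_average_ge (R : realType) (lambda : nat -> nat) (k : nat) (x : X) :
  exact_run (fun k => lambda k.+1) k x ->
  1 / 2 <= 1 / (2 * k.+1)%:R *
    \sum_(0 <= n < 2 * k.+1) f_ R lambda n (iter (2 * k.+1 - n) left_shift x).
Proof.
move=> xk; rewrite (bigD1_seq k.+1) ?iota_uniq ?mem_index_iota//=; last by lia.
(* Shifting [k + 1] times lands just after the digit 1 at coordinate [k], where the zeros begin. *)
have -> : f_ R lambda k.+1 (iter (2 * k.+1 - k.+1) left_shift x) = k.+1%:R.
  rewrite /f_ indicE mem_set ?mulr1// => i il; rewrite iter_left_shift xk.
    by rewrite gtn_eqF//; lia.
  by rewrite mem_iota; lia.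
set r := (\sum_(_ <- _ | _) _).
have r0 : 0 <= r by apply: sumr_ge0 => n _; exact: f_ge0.
rewrite mulrDr [X in _ <= X + _](_ : _ = 1 / 2); last by rewrite natrM; field.
by rewrite lerDl mulr_ge0.
Qed.

(** [limn_esup] is an infimum of suprema over neighbourhoods of infinity, each of which contains a
    tail. *)
Lemma limn_esup_frequently_ge (R : realType) (u : nat -> \bar R) (l : \bar R) :
  (forall n, exists2 k, (n <= k)%N & (l <= u k)%E) -> (l <= limn_esup u)%E.
Proof.
move=> lu; apply: le_ereal_inf_tmp => _ [V [n _ nV] <-].
have [k nk lk] := lu n; apply: (le_trans lk).
by apply: ereal_sup_ubound; exists k => //; exact: nV.
Qed.

Theorem theorem3p4 (R : realType) (mu : probability X R)
    (mu_bernoulli : symmetric_bernoulli mu)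
    (lambda : nat -> nat)
    (lambda_gt0 : forall n, (1 <= n)%N -> (0 < lambda n)%N)
    (lambda_nd : forall m n, (1 <= m)%N -> (m <= n)%N ->
       (lambda m <= lambda n)%N)
    (sum_infty : (\sum_(1 <= n <oo) (1 / 2 ^+ lambda n)%:E)%E = +oo%E :> \bar R)
    (ratio_cvg0 : (n%:R / 2 ^+ lambda n : R) @[n --> \oo] --> (0 : R)) :
  [/\ {ae mu, forall x : X, f_ R lambda n x @[n --> \oo] --> (0 : R)},
      ('N[mu]_1 [EFin \o f_ R lambda n])%E @[n --> \oo] --> (0 : \bar R)%E
    & {ae mu, forall x : X,
        ((1 / 2 : R)%:E <= limn_esup (fun N : nat =>
           (1 / (2 * N)%:R *
            \sum_(0 <= n < 2 * N)
              f_ R lambda n (iter (2 * N - n) left_shift x))%:E))%E}].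
Proof.
(* Both almost-everywhere claims follow from this: one run supplies a digit 1, infinitely many
   supply the large averages. *)
have runs : {ae mu, forall x, lim_sup_set (exact_run (fun k => lambda k.+1)) x}.
  apply: (borel_cantelli_negative_correlation _ _ _ mu _
    (fun k => (2 ^+ (lambda k.+1).+1)^-1)).
  - by move=> k; exact: measurable_cylinder.
  - by move=> k; exact: exact_run_measure.
  - by move=> j k; exact: exact_run_negative_correlation.
  (* The leading 1 of a run halves its probability, hence [2 * C]; the series starts at 1 and the
     runs at 0, hence [n.-1]. *)
  - move=> C; have [|n] := nneseries_pinfty_unbounded _ _ _ (2 * C) _ sum_infty.
      by move=> i; rewrite divr_ge0 ?exprn_ge0.
    rewrite big_add1 => Cn; exists n.-1.
    rewrite -(ltr_pM2l (ltr0n R 2)); apply: (lt_le_trans Cn).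
    rewrite big_distrr /=; apply: ler_sum => k _.
    by rewrite exprS invfM mulrA divff// mul1r.
split.
- apply: filterS runs => x /(_ 0%N I)[k _ xk].
  apply: (@f_cvg0 _ _ _ k) => //.
  by rewrite xk ?eqxx// mem_iota; lia.
- under eq_fun do rewrite Lnorm1_f//.
  by apply: cvg_EFin; first exact: nearW.
- apply: filterS runs => x xr; apply: limn_esup_frequently_ge => n.
  have [k /= nk xk] := xr n I; exists k.+1; first exact: leqW.
  by rewrite lee_fin; exact: exact_run_average_ge.
Qed.
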